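(* Let $A$ be a base-$a$ algorithm whose graph $G(A)$ has the property that there is a fixed number of steps in which the state $1$ can be reached from every state. For any $\varepsilon>0$ let \[ B\coloneqq\Big\{ b\in\mathbb{N} : f_A(b) > \Big(\frac{\mathbb{E}_\pi[C]}{\mathbb{E}_\pi[\log_3\Lambda]}+\varepsilon\Big)\log_3 b\Big\}. \] Then $B$ has logarithmic density zero.
   Context: $f(n)$ is the integer complexity of $n$: the least number of $1$'s needed to write $n$ using $1$, $+$, $\times$ and parentheses; set $f(0)=0$. ''$x\bmod y$'' is the remainder on dividing $x$ by $y$. A base-$a$ algorithm $A$ ($a\ge2$) is given by $\Lambda:X\to\mathbb{N}$, $X=\{0,\dots,a-1\}$, with $\Lambda(i)\ge2$, $\Lambda(i)\mid a$. Applied to $n$: $n_0=n$, $r_i=n_i\bmod a$, $\lambda_i=\Lambda(r_i)$, $s_i=n_i\bmod\lambda_i$, $n_{i+1}=(n_i-s_i)/\lambda_i$, stopping at the first $k$ with $n_k=1$; this yields $n=\lambda_0(\lambda_1(\cdots(\lambda_{k-1}+s_{k-1})\cdots)+s_1)+s_0$. The number of ones used by $A$ is $f_A(n)=\sum_{i=0}^{k-1}C(r_i)$, where $C(i)=f(\Lambda(i))+f(i\bmod\Lambda(i))$. A residue $j$ is a successor of $i$ if some $n\equiv i\pmod a$ has $(n-(n\bmod\Lambda(i)))/\Lambda(i)\equiv j\pmod a$; $G(A)$ is the directed graph on $X$ with an edge $(i,j)$ exactly when $j$ is a successor of $i$. The random walk on $G(A)$ is the Markov chain on $X$ moving from $x$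 to a uniformly random successor of $x$; $\pi$ is its (unique) stationary distribution and $\mathbb{E}_\pi[g]=\sum_x g(x)\pi(x)$. The logarithmic density of $B\subseteq\mathbb{N}$ is $\lim_{N\to\infty}\frac{1}{\log N}\sum_{n\in B,\,n\le N}\frac1n$ when the limit exists. *)

(* Defs.v *)
From mathcomp Require Import all_boot all_order all_algebra.
From mathcomp Require Import all_classical all_reals all_analysis.

Set Implicit Arguments.
Unset Strict Implicit.
Unset Printing Implicit Defensive.

Import Order.TTheory GRing.Theory Num.Theory.
Import numFieldNormedType.Exports.

Local Open Scope classical_set_scope.
Local Open Scope ring_scope.

Inductive expr := One | Add of expr & expr | Mul of expr & expr.

Fixpoint value (e : expr) : nat :=
  match e with
  | One => 1%N
  | Add e1 e2 => (value e1 + value e2)%N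
  | Mul e1 e2 => (value e1 * value e2)%N
  end.

Fixpoint ones (e : expr) : nat :=
  match e with
  | One => 1%N
  | Add e1 e2 | Mul e1 e2 => (ones e1 + ones e2)%N
  end.

Definition writable (n m : nat) : bool :=
  `[< exists e : expr, value e = n /\ ones e = m >].

Lemma writable_ex (n : nat) : exists m, writable n.+1 m.
Proof.
suff [e ve] : exists e, value e = n.+1 by exists (ones e); apply/asboolP; exists e.
elim: n => [|n [e ve]]; first by exists One.
by exists (Add One e); rewrite /= ve.
Qed.

Definition complexity (n : nat) : nat :=
  if n is n'.+1 then ex_minn (writable_ex n') else 0%N.

Record base_algorithm (a : nat) := BaseAlgorithm {
  base_gt1 : (1 < a)%N;
  Lambda : 'I_a -> nat;
  Lambda_gt1 : forall i, (1 < Lambda i)%N;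
  Lambda_dvd : forall i, (Lambda i %| a)%N
}.

Section Algorithm.
Variables (a : nat) (A : base_algorithm a).

Definition residue (n : nat) : 'I_a :=
  Ordinal (ltn_pmod n (ltnW (base_gt1 A))).

Definition state1 : 'I_a := Ordinal (base_gt1 A).

Definition reduce (i : 'I_a) (n : nat) : nat :=
  ((n - n %% Lambda A i) %/ Lambda A i)%N.

(* n_i, started from n_0 = n *)
Definition iterate (n i : nat) : nat :=
  iter i (fun m => reduce (residue m) m) n.

Definition cost (i : 'I_a) : nat :=
  (complexity (Lambda A i) + complexity (i %% Lambda A i))%N.

Definition stops_at (n k : nat) : Prop :=
  iterate n k = 1%N /\ forall j, (j < k)%N -> iterate n j <> 1%N.

(* f_A(n) = m, as a relation: f_A is partial, because a run may jump over 1
   to 0 and never stop (from n_i = 2 when Lambda 2 = 3, say). *)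
Definition fA (n m : nat) : Prop :=
  exists k, stops_at n k /\
    m = (\sum_(i < k) cost (residue (iterate n i)))%N.

Definition successor (i j : 'I_a) : bool :=
  `[< exists n : nat, residue n = i /\ residue (reduce i n) = j >].

Definition reaches1_in_fixed_steps : Prop :=
  exists m : nat, forall x : 'I_a, exists p : seq 'I_a,
    [/\ path successor x p, size p = m & last x p = state1].

Definition walk (R : realType) (x y : 'I_a) : R :=
  if successor x y then (#|[pred z | successor x z]|%:R)^-1 else 0.

Definition stationary (R : realType) (pi : 'I_a -> R) : Prop :=
  [/\ forall x, 0 <= pi x,
      \sum_x pi x = 1 &
      forall y, \sum_x pi x * walk R x y = pi y].

End Algorithm.

Definition expect (R : realType) (a : nat) (pi g : 'I_a -> R) : R :=
  \sum_x g x * pi x.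

Definition log3 (R : realType) (x : R) : R := ln x / ln 3.

Definition log_density (R : realType) (B : set nat) (d : R) : Prop :=
  (fun N : nat => (ln N%:R)^-1 * \sum_(1 <= n < N.+1 | n \in B) (n%:R)^-1 : R)
    @ \oo --> d.

Definition exceptional (R : realType) (a : nat) (A : base_algorithm a)
    (pi : 'I_a -> R) (eps : R) : set nat :=
  [set b | exists2 m : nat, fA A b m &
     (expect pi (fun x => (cost A x)%:R)
        / expect pi (fun x => log3 (Lambda A x)%:R) + eps) * log3 b%:R < m%:R].

(* Main.v *)
(* Let [c] be the ratio of expectations plus [eps] and [G := C - c log_3 Lambda],
   so that [E_pi G < 0].  Since the product of the [lambda_i] is at most [n], every
   exceptional [n] has [\sum_i G(r_i) > 0] along its run.  Weighting each [n] by
   [expR (t \sum_i G(r_i)) / n] and summing over a residue class gives a vector [W]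
   with [W <= 1 + expR (t G) P W], where [P] is the transition matrix of the walk.
   The Poisson equation [h - P h = G - E_pi G] yields, for small [t > 0], a positive
   supersolution proportional to [1 + t h], which bounds [W].  Hence even the sum of
   the reciprocals of the exceptional numbers converges. *)
Require Import Defs.
From mathcomp Require Import all_boot all_order all_algebra.
From mathcomp Require Import all_classical all_reals all_analysis.
From mathcomp Require Import ring lra.

Set Implicit Arguments.
Unset Strict Implicit.
Unset Printing Implicit Defensive.

Import Order.TTheory GRing.Theory Num.Theory.

Local Open Scope ring_scope.

Section Walk.
Variables (R : realType) (a : nat) (A : base_algorithm a).
Implicit Types (x y : 'I_a) (n m k : nat).

(** * Successors and transition probabilities of the walk *)

Lemma reduceE x n : reduce A x n = (n %/ Lambda A x)%N.
Proof.
by rewrite /reduce {1}(divn_eq n (Lambda A x)) addnK mulnK // ltnW ?Lambda_gt1.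
Qed.

Lemma residue_ord x : residue A x = x.
Proof. by apply/val_inj; rewrite /= modn_small. Qed.

Lemma successor_exists x : exists y, successor A x y.
Proof.
exists (residue A (reduce A x x)); apply/asboolP.
by exists (x : nat); split=> //; exact: residue_ord.
Qed.

Lemma successor_reduce n :
  successor A (residue A n) (residue A (reduce A (residue A n) n)).
Proof. by apply/asboolP; exists n. Qed.

(** Write [n = x + a q]. As [Lambda A x] divides [a], changing [q] by a multiple of [Lambda A x]
    changes the quotient by a multiple of [a], so the successor depends only on [q] modulo
    [Lambda A x]. Hence every successor has probability at least [1 / Lambda A x]. *)
Lemma card_successor x : (#|[pred y | successor A x y]| <= Lambda A x)%N.
Proof.
have l0 : (0 < Lambda A x)%N by rewrite ltnW ?Lambda_gt1.
pose s (t : 'I_(Lambda A x)) := residue A ((x + a * t) %/ Lambda A x).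
rewrite -[leqRHS]card_ord; apply: leq_trans (leq_imset_card s _).
apply/subset_leq_card/fintype.subsetP => y /asboolP[n [nx ny]].
apply/imsetP; exists (Ordinal (ltn_pmod (n %/ a) l0)) => //.
rewrite -ny reduceE; apply/val_inj; rewrite /s /=.
have /(congr1 val) /= <- := nx.
have {1}-> : n = (n %% a + a * (n %/ a %% Lambda A x)
                  + (a * (n %/ a %/ Lambda A x)) * Lambda A x)%N.
  rewrite -mulnA -addnA -mulnDr [(_ %% Lambda A x + _)%N]addnC -divn_eq addnC mulnC.
  exact: divn_eq.
by rewrite divnDMl // -modnDmr modnMr addn0.
Qed.

Lemma walk_ge0 x y : 0 <= walk A R x y.
Proof. by rewrite /walk; case: ifP => // _; rewrite invr_ge0. Qed.

Lemma walk_sum1 x : \sum_y walk A R x y = 1.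
Proof.
have c0 : #|[pred z | successor A x z]|%:R != 0 :> R.
  have [y xy] := successor_exists x.
  by rewrite pnatr_eq0 -lt0n; apply/card_gt0P; exists y.
by rewrite /walk -big_mkcond sumr_const -[LHS]mulr_natr mulVf.
Qed.

(** * Harmonic functions and the Poisson equation *)

(** The maximum [h x] is the average of [h] over the successors of [x], so none of them can fall
    below it. *)
Lemma harmonic_max_successor (h : 'I_a -> R) x y :
  (forall z, \sum_y walk A R z y * h y = h z) ->
  (forall z, h z <= h x) -> successor A x y -> h y = h x.
Proof.
move=> hh hx xy.
have /eqP : \sum_y walk A R x y * (h x - h y) = 0.
  under eq_bigr do rewrite mulrBr.
  by rewrite sumrB -mulr_suml walk_sum1 mul1r hh subrr.
rewrite psumr_eq0 => [/allP/(_ y (mem_index_enum _))/=|z _].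
  rewrite mulf_eq0 subr_eq0 /walk xy invr_eq0 pnatr_eq0 => /orP[|/eqP//].
  by rewrite -leqn0 leqNgt => /negP[]; apply/card_gt0P; exists y.
by rewrite mulr_ge0 ?walk_ge0 // subr_ge0.
Qed.

(** The maximum of [h] propagates along a path from a maximiser to state 1. *)
Lemma harmonic_le_state1 (h : 'I_a -> R) x : reaches1_in_fixed_steps A ->
  (forall z, \sum_y walk A R z y * h y = h z) -> h x <= h (state1 A).
Proof.
move=> [m reach] hh.
have [z _ hz] := @arg_maxP _ _ _ (state1 A) xpredT h isT.
have {}hz w : h w <= h z by exact: hz.
have [p [zp _ <-]] := reach z.
apply: le_trans (hz x) _; elim: p z hz zp {reach} => //= y p IH z hz /andP[zy yp].
have e := harmonic_max_successor hh hz zy.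
by rewrite -e; apply: IH => // w; rewrite e.
Qed.

Lemma harmonic_constant (h : 'I_a -> R) x : reaches1_in_fixed_steps A ->
  (forall z, \sum_y walk A R z y * h y = h z) -> h x = h (state1 A).
Proof.
move=> reach hh; apply/le_anti; rewrite harmonic_le_state1 //=.
have := @harmonic_le_state1 (fun z => - h z) x reach; rewrite lerN2; apply=> z.
by under eq_bigr do rewrite mulrN; rewrite sumrN hh.
Qed.

(* [1 - P] has rank [a - 1], since its kernel consists of the constants; so its
   image is the whole hyperplane orthogonal to [pi]. *)
Lemma poisson_equation (pi g : 'I_a -> R) :
  reaches1_in_fixed_steps A -> stationary A pi -> \sum_x g x * pi x = 0 ->
  exists h : 'I_a -> R, forall x, h x - \sum_y walk A R x y * h y = g x.
Proof.
move=> reach [pi_ge0 pi1 piP] gpi.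
(* [M] is the transpose of [1 - P], so that the row [v *m M] is [v - P v]. *)
pose M : 'M[R]_a := \matrix_(y, x) ((x == y)%:R - walk A R x y).
have rowM (v : 'rV[R]_a) x :
    (v *m M) 0 x = v 0 x - \sum_y walk A R x y * v 0 y.
  rewrite mxE; under eq_bigr do rewrite mxE mulrBr.
  rewrite sumrB; congr (_ - _); last by apply: eq_bigr => y _; rewrite mulrC.
  rewrite (bigD1 x) //= eqxx mulr1 big1 ?addr0 // => y /negPf yx.
  by rewrite eq_sym yx mulr0.
pose p : 'cV[R]_a := \col_x pi x.
have Mp : M *m p = 0.
  apply/matrixP => y j; rewrite !mxE; under eq_bigr do rewrite !mxE mulrBl.
  rewrite sumrB (bigD1 y) //= eqxx mul1r big1 => [|x /negPf xy].
    by under [X in _ - X]eq_bigr do rewrite mulrC; rewrite piP addr0 subrr.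
  by rewrite xy mul0r.
have p0 : p != 0.
  apply/eqP => pz; have := oner_neq0 R; rewrite -pi1 big1 ?eqxx // => x _.
  by have /matrixP/(_ x 0) := pz; rewrite !mxE.
have kerM : (kermx M <= (const_mx 1 : 'rV[R]_a))%MS.
  apply/row_subP => i; set v := row i _.
  have vM : v *m M = 0 by apply/sub_kermxP; rewrite row_sub.
  apply/sub_rVP; exists (v 0 (state1 A)); apply/rowP => x; rewrite !mxE mulr1.
  have := @harmonic_constant (v 0) x reach; rewrite /v !mxE; apply=> z.
  have := rowM v z; rewrite vM mxE => /esym/eqP; rewrite subr_eq0 => /eqP <-.
  by [].
have sub : (M <= kermx p)%MS by apply/sub_kermxP.
have eqM : (M == kermx p)%MS.
  rewrite -(mxrank_leqif_eq sub); rewrite eqn_leq mxrankS //= mxrank_ker.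
  have rp : \rank p = 1%N.
    apply/eqP; rewrite eqn_leq lt0n mxrank_eq0 p0 andbT.
    exact: rank_leq_col.
  have := mxrankS kerM; rewrite mxrank_ker rp => /leq_trans/(_ (rank_leq_row _)).
  by rewrite leq_subLR addnC -leq_subLR.
have /submxP[h hg] : ((\row_x g x) <= M)%MS.
  rewrite (eqmxP eqM); apply/sub_kermxP/matrixP => i j; rewrite !mxE -[RHS]gpi.
  by apply: eq_bigr => x _; rewrite !mxE.
by exists (h 0) => x; rewrite -rowM -hg mxE.
Qed.

(** * Weights of runs and a supersolution that bounds them *)

(** On the class of [x] the discarded digit is always [x %% Lambda A x], so division by [Lambda A x]
    is injective there; its values lie in the classes of successors. *)
Lemma sum_reduce_le (F : nat -> R) x N : (forall n, 0 <= F n) ->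
  \sum_(n < N | residue A n == x) F (n %/ Lambda A x)%N <=
  \sum_(y | successor A x y) \sum_(n < N | residue A n == y) F n.
Proof.
move=> F0.
have ltN (n : 'I_N) : (n %/ Lambda A x < N)%N.
  exact: leq_ltn_trans (leq_div _ _) (ltn_ord n).
pose t (n : 'I_N) := Ordinal (ltN n).
pose X := [pred n : 'I_N | residue A n == x].
have t_inj : {in X &, injective t}.
  move=> n m; rewrite !inE => /eqP/(congr1 val) /= nx /eqP/(congr1 val) /= mx.
  move=> /(congr1 val) /= nm; apply/val_inj => /=.
  rewrite (divn_eq n (Lambda A x)) (divn_eq m (Lambda A x)) nm.
  by rewrite -(modn_dvdm n (Lambda_dvd A x)) nx -mx (modn_dvdm m (Lambda_dvd A x)).
have -> : \sum_(n < N | residue A n == x) F (n %/ Lambda A x)%N =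
          \sum_(m in [set t n | n in X]) F m by rewrite (big_imset _ t_inj).
rewrite (partition_big (fun m : 'I_N => residue A m) (successor A x)) /=.
  apply: ler_sum => y _; rewrite [leRHS](bigID (mem [set t n | n in X])) /=.
  rewrite (eq_bigl _ _ (fun _ => andbC _ _)) lerDl.
  by apply: sumr_ge0 => *; apply: F0.
move=> _ /imsetP[n /eqP nx ->] /=.
by have := successor_reduce n; rewrite reduceE nx.
Qed.

Lemma iterate0 k : iterate A 0 k = 0%N.
Proof. by elim: k => //= k ->; rewrite reduceE div0n. Qed.

Lemma iterateS n k : iterate A n k.+1 = iterate A (reduce A (residue A n) n) k.
Proof. by rewrite /iterate iterSr. Qed.

(** A step strictly decreases a positive number. The bound allows runs to be truncated at a fixed
    length. *)
Lemma iterate_eq1_lt n k : iterate A n k = 1%N -> (k < n)%N.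
Proof.
elim: k n => [n|k IH [|n]]; first by rewrite /iterate /= => ->.
  by rewrite iterate0.
by rewrite iterateS reduceE => /IH/leq_trans; apply; rewrite -ltnS ltn_Pdiv ?Lambda_gt1.
Qed.

Lemma prod_Lambda_le n k : iterate A n k = 1%N ->
  (\prod_(i < k) Lambda A (residue A (iterate A n i)) <= n)%N.
Proof.
elim: k n => [n|k IH n]; first by rewrite /iterate /= big_ord0 => ->.
rewrite iterateS big_ord_recl => /IH; set m := reduce _ _ _ => le_m.
apply: leq_trans (_ : Lambda A (residue A n) * m <= n)%N.
  by rewrite leq_mul2l; apply/orP; right; under eq_bigr do rewrite iterateS.
by rewrite /m reduceE mulnC leq_divM.
Qed.

(** Since 1 reduces to 0 and 0 to itself, at most one [k] contributes: the stopping time, if it is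
    below [D]. The truncation [D] is there for induction. *)
Definition run_weight (G : 'I_a -> R) (D n : nat) : R :=
  \sum_(k < D | iterate A n k == 1%N)
    expR (\sum_(i < k) G (residue A (iterate A n i))).

Lemma run_weight_ge0 G D n : 0 <= run_weight G D n.
Proof. by apply: sumr_ge0 => k _; rewrite expR_ge0. Qed.

Lemma run_weight0 G D : run_weight G D 0 = 0.
Proof. by apply: big_pred0 => k; rewrite iterate0. Qed.

Lemma run_weightS G D n : run_weight G D.+1 n =
  (n == 1%N)%:R + expR (G (residue A n)) *
    run_weight G D (n %/ Lambda A (residue A n))%N.
Proof.
rewrite /run_weight big_mkcond big_ord_recl /= big_ord0 expR0; congr (_ + _).
  by case: eqP.
rewrite -big_mkcond mulr_sumr -reduceE; apply: eq_big => [k|k _].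
  by rewrite -iterateS.
rewrite -expRD big_ord_recl; congr (expR (_ + _)).
by apply: eq_bigr => i _; rewrite -iterateS.
Qed.

(* The inequality [1 / (Lambda m + s) <= 1 / (Lambda m)] turns the weights [1/n]
   into the transition probabilities [1 / Lambda] of the walk. *)
Lemma sum_run_weight_le (G u : 'I_a -> R) D N x :
  (forall x, 0 <= u x) ->
  (forall x, 1 + expR (G x) * \sum_y walk A R x y * u y <= u x) ->
  \sum_(n < N | residue A n == x) n%:R^-1 * run_weight G D n <= u x.
Proof.
move=> u0 hu; elim: D x => [|D IH] x.
  by rewrite big1 // => n _; rewrite /run_weight big_ord0 mulr0.
have L0 : (0 < Lambda A x)%N by rewrite ltnW ?Lambda_gt1.
apply: le_trans (hu x); pose F n := n%:R^-1 * run_weight G D n.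
have F0 n : 0 <= F n by rewrite mulr_ge0 ?invr_ge0 ?run_weight_ge0.
have one : \sum_(n < N) (n == 1%N :> nat)%:R = (1 < N)%:R :> R.
  elim: {IH} N => [|N IHN]; first by rewrite big_ord0.
  by rewrite big_ord_recr /= IHN; case: N {IHN} => [|[|N]]; rewrite ?addr0 ?add0r.
have step (n : 'I_N) : residue A n == x ->
    n%:R^-1 * run_weight G D.+1 n <= (n == 1%N :> nat)%:R +
      expR (G x) * ((Lambda A x)%:R^-1 * F (n %/ Lambda A x)%N).
  move=> /eqP nx; rewrite run_weightS nx mulrDr; apply: lerD.
    by case: eqP => [->|_]; rewrite ?mulr0 // invr1 mulr1.
  rewrite mulrCA ler_pM2l ?expR_gt0 // /F mulrA.
  (* For quotient 0 the comparison of reciprocals fails, since [0^-1 = 0], but the weight of 0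
     vanishes. *)
  have [->|m0] := posnP (n %/ Lambda A x)%N; first by rewrite run_weight0 !mulr0.
  rewrite ler_wpM2r ?run_weight_ge0 // -invfM -natrM.
  rewrite lef_pV2 ?posrE ?ltr0n ?muln_gt0 ?L0 //.
    by rewrite ler_nat mulnC leq_divM.
  exact: leq_trans m0 (leq_div _ _).
apply: le_trans (ler_sum _ step) _; rewrite big_split /=; apply: lerD.
  apply: le_trans (_ : \sum_(n < N) (n == 1%N :> nat)%:R <= _).
    by rewrite [leRHS](bigID (fun n : 'I_N => residue A n == x)) /= lerDl sumr_ge0.
  by rewrite one; case: ltnP.
rewrite -mulr_sumr ler_pM2l ?expR_gt0 // -mulr_sumr.
apply: le_trans (ler_wpM2l _ (sum_reduce_le x N F0)) _; first by rewrite invr_ge0.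
rewrite mulr_sumr [leLHS]big_mkcond; apply: ler_sum => y _.
rewrite /walk; case: ifP => xy; last by rewrite mul0r.
apply: ler_pM; rewrite ?invr_ge0 ?sumr_ge0 //.
rewrite lef_pV2 ?posrE ?ltr0n ?L0 ?ler_nat ?card_successor //.
by apply/card_gt0P; exists y.
Qed.

(* First-order perturbation: with [u := 1 + t h] one has
   [expR (t G) P u <= u - t d / 4] for small [t], as [expR s <= 1 / (1 - s)]. *)
Lemma supersolution (G h : 'I_a -> R) (d : R) : 0 < d ->
  (forall x, h x - \sum_y walk A R x y * h y = G x + d) ->
  exists t : R, exists u : 'I_a -> R, [/\ 0 < t, forall x, 0 <= u x &
    forall x, 1 + expR (t * G x) * \sum_y walk A R x y * u y <= u x].
Proof.
move=> d0 hG.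
(* With [t = 1 / (2 M)], both [t h] and [t G] are at most 1/2 in absolute value, and the
   second-order term [t^2 h G] is at most [t d / 2]. *)
pose M := 1 + \sum_x (`|h x| + `|G x| + `|h x * G x| / d).
have leM x : `|h x| + `|G x| + `|h x * G x| / d <= M.
  rewrite /M (bigD1 x) //= addrCA lerDl addr_ge0 ?ler01 // sumr_ge0 // => y _.
  by rewrite !addr_ge0 // divr_ge0 // ltW.
have M0 : 0 < M.
  rewrite ltr_pwDl // sumr_ge0 // => y _.
  by rewrite !addr_ge0 // divr_ge0 // ltW.
pose t := (2 * M)^-1.
have t0 : 0 < t by rewrite invr_gt0 mulr_gt0.
have tM : t * M = 2^-1 by rewrite /t invfM -mulrA mulVf ?mulr1 // gt_eqF.
have small x : [/\ `|t * h x| <= 2^-1, `|t * G x| <= 2^-1 &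
                   `|t * (h x * G x)| <= d / 2].
  have scale v : v <= M -> t * v <= 2^-1 by move=> vM; rewrite -tM ler_pM2l.
  have := leM x; have := normr_ge0 (h x); have := normr_ge0 (G x).
  have : 0 <= `|h x * G x| / d by rewrite divr_ge0 // ltW.
  rewrite ![`|t * _|]normrM (gtr0_norm t0) => w0 G0 h0 le.
  split; [by apply: scale; lra | by apply: scale; lra |].
  by rewrite [leRHS]mulrC -ler_pdivrMr // -mulrA; apply: scale; lra.
(* The scaling turns the gain [t d / 4] into 1, which absorbs the additive 1. *)
pose K := 4 / (t * d).
have K0 : 0 < K by rewrite divr_gt0 // mulr_gt0.
have Ktd : K * (t * d) = 4 by rewrite divfK // mulf_neq0 ?gt_eqF.
exists t, (fun x => K * (1 + t * h x)); split=> // x.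
  have [+ _ _] := small x; rewrite ler_norml => /andP[th _].
  by rewrite mulr_ge0 ?ltW //; lra.
have -> : \sum_y walk A R x y * (K * (1 + t * h y)) =
    K * (1 + t * (h x - (G x + d))).
  rewrite -(hG x) subKr -{2}(walk_sum1 x) mulr_sumr -big_split mulr_sumr.
  by apply: eq_bigr => y _ /=; ring.
have [/ler_normlP[h1 h2] /ler_normlP[g1 g2] /ler_normlP[q1 q2]] := small x.
set E := expR _.
have E0 : 0 < E by exact: expR_gt0.
have E1 : 2^-1 <= E by apply: le_trans (expR_ge1Dx _); lra.
have E2 : E * (1 - t * G x) <= 1.
  have EV : E * expR (- (t * G x)) = 1 by rewrite -expRD subrr expR0.
  by rewrite -[leRHS]EV ler_pM2l //; exact: expR_ge1Dx.
(* The second-order term costs half of the gain [t d]; the factor [E >= 1/2] then halves what is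
   left. *)
have bound : 1 + t * (h x - (G x + d)) <=
    (1 + t * h x) * (1 - t * G x) - t * d / 2.
  have : t * (t * (h x * G x)) <= t * (d / 2) by rewrite ler_pM2l.
  by lra.
have : E * (1 + t * (h x - (G x + d))) <= (1 + t * h x) - t * d / 4.
  apply: le_trans (ler_wpM2l (ltW E0) bound) _.
  have td : 0 < t * d by rewrite mulr_gt0.
  have e1 : (1 + t * h x) * (E * (1 - t * G x)) <= (1 + t * h x) * 1.
    by rewrite ler_wpM2l //; lra.
  have e2 : t * d * 2^-1 <= t * d * E by rewrite ler_pM2l.
  by lra.
rewrite -(ler_pM2l K0) mulrCA => /(lerD (lexx 1))/le_trans; apply.
by lra.
Qed.

End Walk.

(** * Logarithmic density and logarithms to base 3 *)

Lemma log_density0_bounded (R : realType) (B : set nat) (S : R) :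
  (forall N : nat, \sum_(1 <= n < N.+1 | n \in B) n%:R^-1 <= S) ->
  log_density B (0 : R).
Proof.
move=> hS; apply/cvgrPdist_lt => e e0.
have S0 : 0 <= S by apply: le_trans (hS 0%N); rewrite big_geq.
(* Beyond this threshold [ln N] exceeds [S / e]; the summand 1 makes this strict and keeps [ln N]
   positive when [S = 0]. *)
exists (Num.truncn (expR (S / e + 1))).+1 => //= N /= hN.
have lnN : S / e + 1 <= ln (N%:R : R).
  rewrite -ler_expR lnK; last by rewrite posrE ltr0n (leq_trans _ hN).
  by apply: le_trans (ltW (truncnS_gt _)) _; rewrite ler_nat.
have l0 : 0 < ln (N%:R : R).
  by apply: lt_le_trans lnN; rewrite ltr_wpDl // divr_ge0 // ltW.
rewrite sub0r normrN ger0_norm; last first.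
  by rewrite mulr_ge0 ?invr_ge0 ?(ltW l0) // sumr_ge0.
rewrite mulrC ltr_pdivrMr //; apply: le_lt_trans (hS N) _.
rewrite mulrC -ltr_pdivrMr //; apply: lt_le_trans lnN.
by rewrite ltrDl.
Qed.

Lemma log3_gt0 (R : realType) (n : nat) : (1 < n)%N -> 0 < log3 (n%:R : R).
Proof. by move=> n1; rewrite divr_gt0 // ln_gt0 ?ltr1n. Qed.

Lemma le_log3 (R : realType) (m n : nat) : (0 < m <= n)%N ->
  log3 (m%:R : R) <= log3 n%:R.
Proof.
case/andP=> m0 mn; rewrite ler_pM2r ?invr_gt0 ?ln_gt0 ?ltr1n //.
by rewrite ler_ln ?posrE ?ler_nat ?ltr0n // (leq_trans m0).
Qed.

Lemma log3_prod (R : realType) (k : nat) (F : 'I_k -> nat) :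
  (forall i, 0 < F i)%N ->
  log3 ((\prod_(i < k) F i)%N%:R : R) = \sum_(i < k) log3 (F i)%:R.
Proof.
move=> F0; rewrite /log3 -mulr_suml; congr (_ / _).
elim: k F F0 => [|k IH] F F0; first by rewrite !big_ord0 ln1.
by rewrite !big_ord_recl natrM lnM ?posrE ?ltr0n ?prodn_gt0 ?F0 // IH.
Qed.

(** * Convergence of the sum of reciprocals of the exceptional numbers *)

Theorem mainTheorem7 (R : realType) (a : nat) (A : base_algorithm a)
    (pi : 'I_a -> R) (eps : R)
    (hreach : reaches1_in_fixed_steps A)
    (hpi : stationary A pi)
    (heps : 0 < eps) :
  log_density (exceptional A pi eps) (0 : R).
Proof.
have [pi0 pi1 _] := hpi.
pose EC := expect pi (fun x => (cost A x)%:R).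
pose EL := expect pi (fun x => log3 (Lambda A x)%:R).
have EC0 : 0 <= EC by apply: sumr_ge0 => x _; rewrite mulr_ge0.
have EL0 : 0 < EL.
  apply: lt_le_trans (log3_gt0 R (ltnSn 1)) _.
  rewrite (_ : log3 2%:R = \sum_x log3 2%:R * pi x) ; last first.
    by rewrite -mulr_sumr pi1 mulr1.
  apply: ler_sum => x _.
  by apply: ler_wpM2r => //; apply: le_log3; rewrite Lambda_gt1.
pose c := EC / EL + eps.
have c0 : 0 < c by rewrite ltr_wpDl // divr_ge0 // ltW.
pose G x : R := (cost A x)%:R - c * log3 (Lambda A x)%:R.
have [h hG] : exists h : 'I_a -> R,
    forall x, h x - \sum_y walk A R x y * h y = G x + eps * EL.
  (* The mean of [G] is [EC - c EL = - eps EL], so [G + eps EL] has mean zero. *)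
  apply: (poisson_equation hreach hpi).
  under eq_bigr do rewrite /G mulrDl mulrBl -[c * _ * _]mulrA.
  rewrite big_split sumrB -!mulr_sumr pi1 mulr1 /=.
  rewrite -[\sum_i (cost A i)%:R * _]/EC -[\sum_i log3 _ * _]/EL.
  by rewrite /c mulrDl divfK ?gt_eqF // opprD addrA subrr sub0r addNr.
have [t [u [t0 u0 hu]]] := supersolution (mulr_gt0 heps EL0) hG.
apply: (@log_density0_bounded _ _ (\sum_x u x)) => N.
(* Runs from [n <= N] reach 1 in fewer than [N.+1] steps, so this truncation loses none of them. *)
pose W := run_weight A (fun x => t * G x) N.+1.
apply: le_trans (_ : \sum_(n < N.+1) n%:R^-1 * W n <= _).
  rewrite -(big_mkord xpredT (fun n => n%:R^-1 * W n)) [leRHS]big_ltn //.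
  rewrite {1}/W run_weight0 mulr0 add0r [leLHS]big_mkcond /=.
  apply: ler_sum_nat => n /andP[n0 nN].
  case: ifP => [|_]; last by rewrite mulr_ge0 ?invr_ge0 ?run_weight_ge0.
  rewrite in_setE => -[m [k [[nk _] ->]] lt_m].
  rewrite ler_peMr ?invr_ge0 // /W /run_weight.
  have kN : (k < N.+1)%N by exact: ltn_trans (iterate_eq1_lt nk) nN.
  (* The term of the stopping time alone is at least 1, its exponent being positive. *)
  rewrite (bigD1 (Ordinal kN)) /= ?nk //; apply: ler_wpDr.
    by apply: sumr_ge0 => i _; exact: expR_ge0.
  rewrite -expR0 ler_expR -mulr_sumr mulr_ge0 ?ltW //.
  rewrite sumrB -mulr_sumr -log3_prod; last by move=> i; rewrite ltnW ?Lambda_gt1.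
  rewrite subr_gt0 -natr_sum; apply: le_lt_trans lt_m; rewrite ler_pM2l //.
  apply: le_log3; rewrite prod_Lambda_le // andbT prodn_gt0 // => i.
  by rewrite ltnW ?Lambda_gt1.
rewrite (partition_big (fun n : 'I_N.+1 => residue A n) xpredT) //=.
by apply: ler_sum => x _; exact: (sum_run_weight_le N.+1 N.+1 x u0 hu).
Qed.
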